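(* There is a numerical constant $c>0$ such that the following holds. Let $\ell$ be the squared loss $\ell(x,y)=(x-y)^2$ on $\mathcal{X}=\mathcal{Y}=[0,1]$. Consider the game protocol $(p,m,\mathrm{IC})$ described in the context with $K$ experts and horizon $T$, with $m=1$, $p\in\{1,\dots,K\}$ and $\mathrm{IC}\in\{\mathrm{False},\mathrm{True}\}$. Then $$\inf\sup\mathbb{E}[\mathcal{R}_T]\ge c\,\sqrt{KT},$$ where the infimum is over all playing strategies and the supremum is over all individual sequences.
   Context: Write $[n]=\{1,\dots,n\}$. Game protocol $(p,m,\mathrm{IC})$ with $K$ experts and horizon $T$, where $p,m\in[K]$, and $p\le m$ if $\mathrm{IC}=\mathrm{True}$. An individual sequence consists of fixed outcomes $y_t\in\mathcal{Y}$ and expert predictions $F_{i,t}\in\mathcal{X}$, $i\in[K]$, $t\in[T]$, unknown to the learner. At each round $t=1,\dots,T$: (1) the learner chooses $S_t\subseteq[K]$ with $|S_t|=p$ and convex combination weights $(\alpha_{i,t})_{i\in S_t}$ ($\alpha_{i,t}\ge0$, $\sum_{i\in S_t}\alpha_{i,t}=1$); (2) the learner plays $z_t=\sum_{i\in S_t}\alpha_{i,t}F_{i,t}$ and incurs the loss $\ell(z_t,y_t)$; (3) the learner chooses $C_t\subseteq[K]$ with $|C_t|=m$, and with $S_t\subseteq C_t$ if $\mathrm{IC}=\mathrm{True}$ (no inclusion is required if $\mathrm{IC}=\mathrm{False}$); (4) the losses $\ell(F_{i,t},y_t)$, $i\in C_t$, are revealed to the learner. A playing strategy determines the learner's choices from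 its past observations (the sets and losses revealed so far) and possibly internal randomization. The regret is $\mathcal{R}_T=\sum_{t=1}^T\ell(z_t,y_t)-\min_{i\in[K]}\sum_{t=1}^T\ell(F_{i,t},y_t)$, and $\mathbb{E}$ is the expectation over the learner's randomization.
   Formalization: The bound is stated for K ≥ 2 and T ≥ K only; without such conditions it is false: for K = 1 the regret is always 0, and for T = 1 with K > 1/c² the regret is at most 1 < c√(KT). *)

(* Defs.v *)
From HB Require Import structures.
From mathcomp Require Import all_boot all_order all_algebra.
From mathcomp Require Import all_classical all_reals all_analysis.

Set Implicit Arguments.
Unset Strict Implicit.
Unset Printing Implicit Defensive.

Import Order.TTheory GRing.Theory Num.Theory.
Import numFieldNormedType.Exports.

Local Open Scope classical_set_scope.
Local Open Scope ring_scope.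

(* Experts are numbered 0, ..., K-1 and rounds 0, ..., T-1. *)

(* [o i = Some x] iff expert [i] was queried ([i \in C_t]) and [x] is the
   revealed loss, so an observation carries both the set [C_t] and the losses
   of its members. *)
Definition observation (R : realType) (K : nat) := {ffun 'I_K -> option R}.

(* Observations of the past rounds in chronological order; the current round
   is the length of the history. *)
Definition history (R : realType) (K : nat) := seq (observation R K).

(* The internal randomization is a point of the probability space carried by
   [Om].  Since [Om] is available at every round, the learner's own past
   choices are functions of that point and of the observations, and need not
   be listed in the history.  No loss is revealed between the choices of
   [S_t] and [C_t], hence both depend on the same history.  A history takes
   finitely many values along a fixed individual sequence, so measurability of
   the choices at each history makes the regret a random variable. *)
Record strategy (R : realType) (K p m : nat) (IC : bool)
    (d : measure_display) (Om : measurableType d) := Strategy {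
  played : history R K -> Om -> {set 'I_K};                    (* S_t *)
  weight : history R K -> 'I_K -> Om -> R;                     (* alpha_{i,t} *)
  queried : history R K -> Om -> {set 'I_K};                   (* C_t *)
  card_played : forall h w, #|played h w| = p;
  weight_ge0 : forall h w i, i \in played h w -> 0 <= weight h i w;
  weight_sum1 : forall h w, \sum_(i in played h w) weight h i w = 1;
  card_queried : forall h w, #|queried h w| = m;
  played_sub_queried : forall h w, IC -> played h w \subset queried h w;
  measurable_played : forall h (S : {set 'I_K}),
    measurable [set w | played h w = S];
  measurable_weight : forall h i, measurable_fun [set: Om] (weight h i);
  measurable_queried : forall h (C : {set 'I_K}),
    measurable [set w | queried h w = C] }.

Definition sqloss (R : realType) (x y : R) : R := (x - y) ^+ 2.

Section Game.
Context (R : realType) (loss : R -> R -> R) (K T : nat).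

(* Only the values at the rounds [t < T] are constrained, and only these
   matter for the regret at horizon [T]. *)
Definition individual_sequence (X Y : set R)
    (F : 'I_K -> nat -> R) (y : nat -> R) : Prop :=
  forall t, (t < T)%N -> Y (y t) /\ forall i, X (F i t).

Section Play.
Context (p m : nat) (IC : bool) (d : measure_display) (Om : measurableType d).
Context (A : strategy R K p m IC Om).
Context (F : 'I_K -> nat -> R) (y : nat -> R).

Fixpoint past (t : nat) (w : Om) : history R K :=
  if t is t'.+1 then
    let h := past t' w in
    rcons h [ffun i => if i \in queried A h w
                       then Some (loss (F i t') (y t')) else None]
  else [::].

Definition prediction (t : nat) (w : Om) : R :=
  \sum_(i in played A (past t w) w) weight A (past t w) i w * F i t.

(* The infimum is over a finite family, nonempty when [0 < K]: it is the
   minimum over the experts. *)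
Definition regret (w : Om) : R :=
  \sum_(t < T) loss (prediction t w) (y t)
  - inf (range (fun i : 'I_K => \sum_(t < T) loss (F i t) (y t))).

End Play.

Definition worst_case_regret (X Y : set R) (p m : nat) (IC : bool)
    (d : measure_display) (Om : measurableType d) (P : probability Om R)
    (A : strategy R K p m IC Om) : \bar R :=
  ereal_sup [set r : \bar R | exists (F : 'I_K -> nat -> R) (y : nat -> R),
    individual_sequence X Y F y /\ r = 'E_P[regret A F y]%E].

(* A playing strategy comes with the probability space of its internal
   randomization. *)
Definition minimax_regret (X Y : set R) (p m : nat) (IC : bool) : \bar R :=
  ereal_inf [set r : \bar R |
    exists (d : measure_display) (Om : measurableType d)
           (P : probability Om R) (A : strategy R K p m IC Om),
      r = worst_case_regret X Y P A].

End Game.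

(* Main.v *)
Require Import Defs.
From mathcomp Require Import all_boot all_order all_algebra.
From mathcomp Require Import all_classical all_reals all_analysis.
From mathcomp Require Import measurable_realfun ring lra.

Import Order.TTheory GRing.Theory Num.Theory.
Import numFieldNormedType.Exports.

Local Open Scope classical_set_scope.
Local Open Scope ring_scope.

(** The lower bound is a bandit lower bound, for a randomly drawn individual
    sequence against which mixing experts does not pay.

    All outcomes are [0].  Fix a hidden expert [i] and draw two independent
    coins in every round: a fair one, and a rare one of bias [d].  All experts
    predict the value of the fair coin, except that expert [i] predicts [0]
    when the rare coin shows up.  The experts thus disagree only when both
    coins show up, and a learner that plays the weights [a] then loses
    [(1 - a i) ^+ 2] more than expert [i], and loses exactly as much as [i]
    in all other cases ([sqloss_mixture]).  So a learner that knows nothing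
    about [i] pays of the order of [d] per round: for all [a] in the simplex,
    [(1 - a i) ^+ 2] averaged over [i] is at least [1 / 4]
    as soon as [K >= 2] ([sum_sqr_onem_ge]).  The curvature of the squared
    loss is harmless since all experts but [i] predict the same: mixing
    reduces the excess only through the weight on [i], and the weights of all
    possible [i] sum to [1].

    What the learner sees is one bit per round: the loss of the queried
    expert.  It is a fair bit, unless [i] is queried, in which case it is [1]
    with probability [(1 - d) / 2].  With [L] the likelihood ratio of the
    observed bits to fair bits, expectations in the game with hidden expert
    [i] are expectations of [L * f] over fair bits ([word_mean_observed]).
    The loss [E [f * (1 - L)]] in passing from one law to the other is at most
    [(b + 1)^-1 + b * E [- ln L]] for every [b > 0]
    ([mulr_subl1_le_ln]), a version of Pinsker's inequality that is
    linear in the relative entropy, and [E [- ln L]] is at most [d ^+ 2] times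
    the expected number of queries of [i] for [d ^+ 2 <= 1 / 2]
    ([word_mean_opp_ln_likelihood]).  These numbers add up to at most
    [T] over all [i] because there is a single query per round, so that for
    [d] of the order of [sqrt (K / T)] the learner cannot identify a typical
    [i], and its regret is of the order of [d * T], i.e. [sqrt (K * T)]
    ([sum_word_mean_regret_ge]).

    All of this holds for each value of the learner's internal randomness.
    Since the coins range over a finite set of words, the expectation over
    that randomness commutes with the mean over the coins
    ([Rintegral_word_mean]), and some hidden expert and some word of coins
    are at least as bad as the average ([exists_bad_forecast]).  This
    needs the regret to be integrable, which rests on the
    finiteness of the set of histories along a fixed sequence
    ([measurable_finite_select], [past_finite_measurable]). *)

(** * Means over random words *)

Section WordMean.
Context {R : realType} {X : finType} (w : X -> R).

(** The expectation of [g] at a word of [n] independent letters of law [w].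
    Peeling off the last letter makes it fit the histories of a game, which
    grow at their end. *)
Fixpoint word_mean (n : nat) (g : seq X -> R) : R :=
  if n is n'.+1 then word_mean n' (fun s => \sum_x w x * g (rcons s x))
  else g [::].

Lemma eq_word_mean n f g : (forall s, size s = n -> f s = g s) ->
  word_mean n f = word_mean n g.
Proof.
elim: n f g => [|n IHn] f g fg /=; first exact: fg.
by apply: IHn => s sn; apply: eq_bigr => x _; rewrite fg// size_rcons sn.
Qed.

Lemma word_mean_sum I (r : seq I) n (g : I -> seq X -> R) :
  word_mean n (fun s => \sum_(i <- r) g i s) = \sum_(i <- r) word_mean n (g i).
Proof.
elim: n g => [//|n IHn] g /=; rewrite -IHn; apply: eq_word_mean => s _.
by rewrite exchange_big; apply: eq_bigr => x _; rewrite mulr_sumr.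
Qed.

Lemma word_meanZ n c g : word_mean n (fun s => c * g s) = c * word_mean n g.
Proof.
elim: n g => [//|n IHn] g /=; rewrite -IHn; apply: eq_word_mean => s _.
by rewrite mulr_sumr; apply: eq_bigr => x _; rewrite mulrCA.
Qed.

Lemma word_meanD n f g :
  word_mean n (fun s => f s + g s) = word_mean n f + word_mean n g.
Proof.
elim: n f g => [//|n IHn] f g /=; rewrite -IHn; apply: eq_word_mean => s _.
by rewrite -big_split; apply: eq_bigr => x _; rewrite mulrDr.
Qed.

Hypothesis w_ge0 : forall x, 0 <= w x.

Lemma le_word_mean n f g : (forall s, size s = n -> f s <= g s) ->
  word_mean n f <= word_mean n g.
Proof.
elim: n f g => [|n IHn] f g fg /=; first exact: fg.
apply: IHn => s sn; apply: ler_sum => x _.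
by rewrite ler_wpM2l// fg// size_rcons sn.
Qed.

Hypothesis w_sum1 : \sum_x w x = 1.

Lemma word_mean_cst n c : word_mean n (fun=> c) = c.
Proof.
elim: n => [//|n IHn] /=; rewrite -[RHS]IHn; apply: eq_word_mean => s _.
by rewrite -mulr_suml w_sum1 mul1r.
Qed.

Lemma word_mean_take t n g : (t <= n)%N ->
  word_mean n (fun s => g (take t s)) = word_mean t g.
Proof.
elim: n => [|n IHn]; first by rewrite leqn0 => /eqP->.
rewrite leq_eqVlt => /predU1P[->|tn].
  by apply: eq_word_mean => s <-; rewrite take_size.
rewrite -IHn//=; apply: eq_word_mean => s sn.
under eq_bigr => x _ do rewrite -cats1 take_cat sn.
have [tn'|tn'] := ltnP; first by rewrite -mulr_suml w_sum1 mul1r.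
have -> : t = n by apply/eqP; rewrite eqn_leq tn' -ltnS tn.
rewrite subnn; under eq_bigr => x _ do rewrite cats0.
by rewrite -mulr_suml w_sum1 mul1r -sn take_size.
Qed.

Lemma weighted_mean_attained (f : X -> R) : exists x, \sum_y w y * f y <= f x.
Proof.
have [x0 _|X0] := pickP X; last first.
  by move/eqP: w_sum1; rewrite big_pred0// eq_sym oner_eq0.
case: (arg_maxP f (isT : xpredT x0)) => x _ fx.
exists x; rewrite -[leRHS]mul1r -w_sum1 mulr_suml.
by apply: ler_sum => y _; apply: ler_wpM2l => //; exact: fx.
Qed.

Lemma word_mean_attained n g : exists2 s, size s = n & word_mean n g <= g s.
Proof.
elim: n g => [|n IHn] g; first by exists [::].
have [s sn gs] := IHn (fun s => \sum_x w x * g (rcons s x)).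
have [x gx] := weighted_mean_attained (fun x => g (rcons s x)).
by exists (rcons s x); [rewrite size_rcons sn|exact: le_trans gs gx].
Qed.

End WordMean.

(** * Logarithmic bounds *)

Section LnBounds.
Context {R : realType}.

Lemma ln_le_subr1 (x : R) : 0 < x -> ln x <= x - 1.
Proof. by move=> x0; rewrite -[in ln _](subrKC 1 x) le_ln1Dx//; lra. Qed.

(** The case [f = 1] is the tangent line of the concave function [ln] at
    [b / (b + 1)].  After taking means, this bounds the effect of a change of
    law by the relative entropy; the additive constant can be made small, and
    being linear in the entropy the bound can be summed over experts without
    convexity arguments. *)
Lemma mulr_subl1_le_ln (b f L : R) : 0 < b -> 0 <= f <= 1 -> 0 < L ->
  f * (1 - L) <= (b + 1)^-1 + b * (L - 1 - ln L).
Proof.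
move=> b0 /andP[f0 f1] L0.
have Ll : 0 <= L - 1 - ln L by rewrite subr_ge0 ln_le_subr1.
have b1 : 0 < b + 1 by lra.
have ib1 : 0 < (b + 1)^-1 by rewrite invr_gt0.
have : 1 - L <= (b + 1)^-1 + b * (L - 1 - ln L).
  have r0 : 0 < (b + 1) / b by rewrite divr_gt0.
  have s0 : 0 < b / (b + 1) by rewrite divr_gt0.
  have lnE : ln L = ln ((b + 1) / b * L) + ln (b / (b + 1)).
    rewrite -lnM ?posrE//; last exact: mulr_gt0.
    congr (ln _); field.
    by rewrite !gt_eqF.
  have l1 := ln_le_subr1 _ (mulr_gt0 r0 L0).
  have l2 := ln_le_subr1 _ s0.
  have : b * ln L <= (b + 1) * L - b - b * (b + 1)^-1.
    have -> : (b + 1) * L - b - b * (b + 1)^-1 =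
        b * ((b + 1) / b * L - 1 + (b / (b + 1) - 1)).
      by field; rewrite !gt_eqF.
    by rewrite ler_pM2l// lnE lerD.
  have : b * (b + 1)^-1 = 1 - (b + 1)^-1 by field; rewrite gt_eqF.
  lra.
have [L1|L1] := leP L 1; first by nra.
have : 0 <= b * (L - 1 - ln L) by apply: mulr_ge0 => //; lra.
nra.
Qed.

Lemma opp_ln1B_le (x : R) : 0 <= x <= 2^-1 -> - ln (1 - x) <= 2 * x.
Proof.
move=> /andP[x0 x1]; have y0 : 0 < 1 - x by lra.
rewrite -lnV ?posrE//; apply: le_trans (ln_le_subr1 _ _) _.
  by rewrite invr_gt0.
have -> : (1 - x)^-1 - 1 = x / (1 - x) by field; rewrite gt_eqF.
by rewrite ler_pdivrMr//; nra.
Qed.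

End LnBounds.

(** * A hidden expert and the bits that a learner observes *)

Section HiddenExpert.
Context {R : realType} {K : nat}.
Implicit Types (i j : 'I_K) (q : seq bool -> 'I_K) (d : R) (b : seq bool).

Definition fair : bool -> R := fun=> 2^-1.

Definition coins d (u : bool * bool) : R :=
  2^-1 * (if u.2 then d else 1 - d).

(** [u.1] is the fair coin and [u.2] the rare one. *)
Definition advice i (u : bool * bool) j : bool := u.1 && ~~ (u.2 && (j == i)).

(** [q] chooses the expert to query from the bits observed so far. *)
Definition observed q i (s : seq (bool * bool)) : seq bool :=
  foldl (fun b u => rcons b (advice i u (q b))) [::] s.

(** The ratio of the law of the next observed bit to that of a fair bit. *)
Definition tilt q i d b (x : bool) : R :=
  if q b == i then if x then 1 - d else 1 + d else 1.

Definition likelihood q i d b : R :=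
  \prod_(t < size b) tilt q i d (take t b) (nth false b t).

Lemma likelihood_rcons q i d b x :
  likelihood q i d (rcons b x) = likelihood q i d b * tilt q i d b x.
Proof.
rewrite /likelihood size_rcons big_ord_recr/= nth_rcons ltnn eqxx.
rewrite -cats1 take_size_cat//; congr (_ * _); apply: eq_bigr => t _.
by rewrite take_cat nth_cat ltn_ord.
Qed.

Lemma fair_ge0 x : 0 <= fair x. Proof. by rewrite invr_ge0. Qed.

Lemma fair_sum1 : \sum_x fair x = 1.
Proof. by rewrite big_bool/= /fair; lra. Qed.

Lemma sum_pair_bool (f : bool * bool -> R) : \sum_u f u =
  f (true, true) + f (true, false) + (f (false, true) + f (false, false)).
Proof.
transitivity (\sum_u f (u.1, u.2)); first by apply: eq_bigr => -[].
by rewrite -(pair_bigA _ (fun x y => f (x, y))) !big_bool.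
Qed.

Lemma coins_ge0 d u : 0 <= d <= 1 -> 0 <= coins d u.
Proof.
by move=> /andP[d0 d1]; rewrite mulr_ge0 ?invr_ge0//; case: ifP => _; lra.
Qed.

Lemma coins_sum1 d : \sum_u coins d u = 1.
Proof. by rewrite sum_pair_bool /coins/=; lra. Qed.

Lemma observed_rcons q i s u :
  observed q i (rcons s u) =
  rcons (observed q i s) (advice i u (q (observed q i s))).
Proof. by rewrite /observed foldl_rcons. Qed.

(** The law of the observed bits has density [likelihood q i d] with respect
    to that of fair bits. *)
Lemma word_mean_observed q i d n (f : seq bool -> R) :
  word_mean (coins d) n (fun s => f (observed q i s)) =
  word_mean fair n (fun b => likelihood q i d b * f b).
Proof.
elim: n f => [|n IHn] f /=; first by rewrite /likelihood big_ord0 mul1r.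
under eq_word_mean => s _ do under eq_bigr => u _ do rewrite observed_rcons.
rewrite (IHn (fun b => \sum_u coins d u * f (rcons b (advice i u (q b))))).
apply: eq_word_mean => b _.
rewrite sum_pair_bool big_bool/= !likelihood_rcons /tilt /coins /fair /advice/=.
by case: eqP => _ /=; field.
Qed.

Lemma likelihood_gt0 q i d b : 0 <= d < 1 -> 0 < likelihood q i d b.
Proof.
move=> /andP[d0 d1]; apply: prodr_gt0 => t _; rewrite /tilt.
by case: ifP => _; [case: ifP => _|]; lra.
Qed.

Lemma word_mean_likelihood q i d n : word_mean fair n (likelihood q i d) = 1.
Proof.
rewrite -(word_mean_cst _ (coins_sum1 d) n 1).
rewrite (word_mean_observed q i d n (fun=> 1)).
by apply: eq_word_mean => b _; rewrite mulr1.
Qed.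

(** The chain rule of relative entropy: given the past, a query of [i] adds
    [- ln (1 - d ^+ 2) / 2] to the relative entropy, and any other query
    adds nothing. *)
Lemma word_mean_opp_ln_likelihood q i d n : 0 <= d -> d ^+ 2 <= 2^-1 ->
  word_mean fair n (fun b => - ln (likelihood q i d b)) <=
  d ^+ 2 * \sum_(t < n) word_mean fair t (fun b => (q b == i)%:R).
Proof.
move=> d0 d2; have d1 : d < 1 by rewrite expr2 in d2; nra.
have Lgt0 b : 0 < likelihood q i d b by rewrite likelihood_gt0// d0.
elim: n => [|n IHn].
  by rewrite /= /likelihood !big_ord0 ln1 oppr0 mulr0.
rewrite big_ord_recr/= mulrDr; apply: le_trans (lerD IHn (lexx _)).
rewrite -word_meanZ -word_meanD; apply: le_word_mean => [|b _].
  exact: fair_ge0.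
rewrite big_bool/= !likelihood_rcons /fair /tilt; case: eqP => _; last first.
  by rewrite mulr1 /=; lra.
rewrite !lnM ?posrE//; try lra.
have : - ln (1 - d ^+ 2) <= 2 * d ^+ 2 by rewrite opp_ln1B_le// sqr_ge0.
have -> : 1 - d ^+ 2 = (1 - d) * (1 + d) by ring.
by rewrite lnM ?posrE ?mulr1; lra.
Qed.

(** An expert that is rarely queried under fair bits can hardly be told from
    the others: the law of the bits observed when it is hidden is close to
    the fair one. *)
Lemma word_mean_change_of_law q i d n (b : R) (f : seq bool -> R) :
  0 <= d -> d ^+ 2 <= 2^-1 -> 0 < b -> (forall s, 0 <= f s <= 1) ->
  word_mean fair n f - (b + 1)^-1 -
    b * (d ^+ 2 * \sum_(t < n) word_mean fair t (fun s => (q s == i)%:R)) <=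
  word_mean (coins d) n (fun s => f (observed q i s)).
Proof.
move=> d0 d2 b0 f01; have d1 : d < 1 by rewrite expr2 in d2; nra.
rewrite word_mean_observed -subr_ge0; set L := likelihood q i d.
have : word_mean fair n (fun s => f s * (1 - L s)) <=
    word_mean fair n (fun s => (b + 1)^-1 + b * (L s - 1 - ln (L s))).
  apply: le_word_mean => [x|s _]; first exact: fair_ge0.
  by rewrite mulr_subl1_le_ln// likelihood_gt0// d0.
under eq_word_mean => s _ do rewrite mulrBr mulr1 -mulN1r (mulrC (f s)).
rewrite word_meanD word_meanZ.
rewrite word_meanD word_meanZ.
under [X in _ <= _ + _ * X]eq_word_mean => s _ do rewrite -addrA.
rewrite !word_meanD word_mean_likelihood !(word_mean_cst _ fair_sum1).
have := word_mean_opp_ln_likelihood q i d n d0 d2; rewrite -/L => le_ln.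
have := ler_wpM2l (ltW b0) le_ln.
by move=> H1 H2; move: H1; rewrite /L in H2 *; lra.
Qed.

End HiddenExpert.

(** * The sum over all hidden experts *)

(** [(1 - x) ^+ 2 >= 3 / 4 - x], the tangent at [1 / 2]; the right-hand sides
    sum to [3 / 4 * K - 1], which is at least [K / 4] for [K >= 2]. *)
Lemma sum_sqr_onem_ge (R : realType) (K : nat) (a : 'I_K -> R) :
  (2 <= K)%N -> \sum_i a i = 1 -> K%:R / 4 <= \sum_i (1 - a i) ^+ 2.
Proof.
move=> K2 a1.
have : \sum_i (3 / 4 - a i) <= \sum_i (1 - a i) ^+ 2.
  apply: ler_sum => i _; rewrite -subr_ge0.
  have -> : (1 - a i) ^+ 2 - (3 / 4 - a i) = (a i - 1 / 2) ^+ 2 by field.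
  exact: sqr_ge0.
rewrite sumrB a1 sumr_const card_ord -[X in X - _ <= _]mulr_natr.
have : 2 <= K%:R :> R by rewrite ler_nat.
lra.
Qed.

(** The expected numbers of queries in [word_mean_change_of_law] sum to [n],
    since each round has a single query; the relative entropy per expert is
    thus of the order of [n / K]. *)
Lemma sum_word_mean_sqr_onem_ge (R : realType) (K n : nat) (d b : R)
    (q : seq bool -> 'I_K) (a : seq bool -> 'I_K -> R) :
  (2 <= K)%N -> 0 <= d -> d ^+ 2 <= 2^-1 -> 0 < b ->
  (forall s i, 0 <= a s i) -> (forall s, \sum_i a s i = 1) ->
  K%:R * (4^-1 - (b + 1)^-1) - b * (d ^+ 2 * n%:R) <=
  \sum_i word_mean (coins d) n (fun s => (1 - a (observed q i s) i) ^+ 2).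
Proof.
move=> K2 d0 d2 b0 a0 a1.
have ale1 s i : a s i <= 1.
  by rewrite -(a1 s) (bigD1 i)//= lerDl sumr_ge0.
have f01 i s : 0 <= (1 - a s i) ^+ 2 <= 1.
  by rewrite sqr_ge0/= expr_le1// ?subr_ge0 ?lerBlDr ?lerDl.
apply: le_trans (ler_sum _ (fun i _ =>
  word_mean_change_of_law q i d n b _ d0 d2 b0 (f01 i))).
rewrite sumrB sumrB -word_mean_sum sumr_const card_ord.
rewrite -[(_ + _)^-1 *+ K]mulr_natl.
rewrite -mulr_sumr -mulr_sumr exchange_big/=.
have -> : \sum_(t < n) \sum_(i < K)
    word_mean fair t (fun s => (q s == i)%:R) = n%:R :> R.
  rewrite -[n in RHS]card_ord -sumr_const; apply: eq_bigr => t _.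
  rewrite -word_mean_sum -[RHS](word_mean_cst _ fair_sum1 t).
  apply: eq_word_mean => s _; rewrite (bigD1 (q s))//= eqxx big1 ?addr0//.
  by move=> i; rewrite eq_sym => /negbTE ->.
rewrite mulrBr lerD2r lerD2r -[leLHS](word_mean_cst _ fair_sum1 n).
by apply: le_word_mean => [x|s _]; [exact: fair_ge0|exact: sum_sqr_onem_ge].
Qed.

(** * The regret for a fixed value of the internal randomness *)

Definition forecast (R : realType) (K : nat) (i : 'I_K)
    (s : seq (bool * bool)) (j : 'I_K) (t : nat) : R :=
  (advice i (nth (false, false) s t) j)%:R.

Lemma forecast01 (R : realType) (K : nat) (i : 'I_K) s j t :
  0 <= forecast R K i s j t <= 1.
Proof. by rewrite ler0n lern1 leq_b1. Qed.

Section FixedRandomness.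
Context {R : realType} {K p : nat} {IC : bool} {dOm : measure_display}
  {Om : measurableType dOm}.
Variables (A : strategy R K p 1 IC Om) (w : Om).

(** The weights extended by [0] to all experts, so that they form a point of a
    simplex that does not depend on the played set. *)
Definition mixture (h : history R K) (i : 'I_K) : R :=
  if i \in played A h w then weight A h i w else 0.

Lemma mixture_ge0 h i : 0 <= mixture h i.
Proof. by rewrite /mixture; case: ifP => // /weight_ge0. Qed.

Lemma mixture_sum1 h : \sum_i mixture h i = 1.
Proof. by rewrite -big_mkcond weight_sum1. Qed.

Lemma predictionE (F : 'I_K -> nat -> R) y t :
  prediction (@sqloss R) A F y t w =
  \sum_i mixture (past (@sqloss R) A F y t w) i * F i t.
Proof.
rewrite /prediction big_mkcond; apply: eq_bigr => i _.
by rewrite /mixture; case: ifP; rewrite ?mul0r.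
Qed.

(** When both coins show up, [i] alone predicts [0] and the mixture predicts
    [1 - a i]; otherwise all experts agree. *)
Lemma sqloss_mixture (a : 'I_K -> R) i u : \sum_j a j = 1 ->
  sqloss (\sum_j a j * (advice i u j)%:R) 0 - sqloss (advice i u i)%:R 0 =
  (u.1 && u.2)%:R * (1 - a i) ^+ 2.
Proof.
rewrite /sqloss /advice; case: u => [[] []]/= a1.
- rewrite eqxx/= !subr0 expr0n/= subr0 mul1r; congr (_ ^+ 2).
  rewrite -[1 in RHS]a1 (bigD1 i)//= eqxx mulr0 add0r [in RHS](bigD1 i)//=.
  rewrite addrAC subrr add0r.
  by apply: eq_bigr => j /negbTE ->; rewrite mulr1.
- by under eq_bigr => j _ do rewrite mulr1; rewrite a1 subr0 subrr mul0r.
- by rewrite big1 ?subrr ?mul0r// => j _; rewrite mulr0.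
- by rewrite big1 ?subrr ?mul0r// => j _; rewrite mulr0.
Qed.

Lemma regret_forecast_ge T i s :
  \sum_(t < T) ((nth (false, false) s t).1 && (nth (false, false) s t).2)%:R
    * (1 - mixture (past (@sqloss R) A (forecast R K i s) (fun=> 0) t w) i) ^+ 2
  <= regret (@sqloss R) T A (forecast R K i s) (fun=> 0) w.
Proof.
rewrite /regret lerBrDr -lerBrDl.
under [X in _ <= X - _]eq_bigr => t _ do rewrite predictionE.
rewrite -sumrB.
under [leRHS]eq_bigr => t _.
  rewrite -(sqloss_mixture _ _ _ (mixture_sum1 _)) opprB addrCA subrr addr0.
  over.
apply: ge_inf => /=; last by exists i.
by exists 0 => _ [j _ <-]; apply: sumr_ge0 => t _; exact: sqr_ge0.
Qed.

Definition reply (j : 'I_K) (x : bool) : observation R K :=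
  [ffun i => if i == j then Some x%:R else None].

(** The history can be recovered from the observed bits alone, because a
    strategy with fixed internal randomness determines its queries. *)
Definition transcript (q : history R K -> 'I_K) (b : seq bool) : history R K :=
  foldl (fun h x => rcons h (reply (q h) x)) [::] b.

Lemma past_forecast q i s t : (forall h, queried A h w = [set q h]%SET) ->
  (t <= size s)%N ->
  past (@sqloss R) A (forecast R K i s) (fun=> 0) t w =
  transcript q (observed (q \o transcript q) i (take t s)).
Proof.
move=> qE; elim: t => [|t IHt] ts; first by rewrite take0.
rewrite (take_nth (false, false) ts) observed_rcons /transcript foldl_rcons.
rewrite -/(transcript q _) /= IHt 1?ltnW//; congr rcons.
apply/ffunP => j; rewrite !ffunE qE inE /=; case: eqP => // ->.
by rewrite /sqloss /forecast subr0; case: advice; rewrite ?expr1n ?expr0n.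
Qed.

(** The learner's queries and weights are functions of the observed bits, so
    the rounds contribute one by one the bounds of
    [sum_word_mean_sqr_onem_ge]. *)
Lemma sum_word_mean_regret_ge T (d b : R) : (2 <= K)%N ->
  0 <= d -> d ^+ 2 <= 2^-1 -> 0 < b ->
  d / 2 * T%:R * (K%:R * (4^-1 - (b + 1)^-1) - b * (d ^+ 2 * T%:R)) <=
  \sum_i word_mean (coins d) T
    (fun s => regret (@sqloss R) T A (forecast R K i s) (fun=> 0) w).
Proof.
move=> K2 d0 d2 b0; have d1 : d <= 1 by rewrite expr2 in d2; nra.
have d01 : 0 <= d <= 1 by rewrite d0.
have /choice[q qE] h : exists j, queried A h w = [set j]%SET.
  by apply/cards1P; rewrite card_queried.
pose q' := q \o transcript q.
pose a b i := mixture (transcript q b) i.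
have step (i : 'I_K) : \sum_(t < T) d / 2 *
    word_mean (coins d) t (fun s => (1 - a (observed q' i s) i) ^+ 2) <=
  word_mean (coins d) T
    (fun s => regret (@sqloss R) T A (forecast R K i s) (fun=> 0) w).
  (* The weights of round t depend on the coins of the rounds before t, which
     are independent of those of round t; both show up with probability
     d / 2. *)
  apply: le_trans (le_word_mean _ (fun u => coins_ge0 d u d01) _ _ _
    (fun s _ => regret_forecast_ge T i s)).
  rewrite word_mean_sum; apply: ler_sum => t _; rewrite -word_meanZ.
  rewrite le_eqVlt; apply/orP; left; apply/eqP.
  pose g s : R :=
    ((nth (false, false) s t).1 && (nth (false, false) s t).2)%:R *
    (1 - a (observed q' i (take t s)) i) ^+ 2.
  transitivity (word_mean (coins d) T (fun s => g (take t.+1 s))).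
    rewrite (word_mean_take _ (coins_sum1 d))//=; apply: eq_word_mean => s st.
    under eq_bigr => u _ do
      rewrite /g nth_rcons st ltnn eqxx -cats1 take_size_cat//.
    by rewrite sum_pair_bool /coins/=; field.
  apply: eq_word_mean => s sT.
  by rewrite /g nth_take// take_takel// (past_forecast q)// sT ltnW.
apply: le_trans (ler_sum _ (fun i _ => step i)).
rewrite exchange_big/=; set X := (X in _ * X).
have -> : d / 2 * T%:R * X = \sum_(t < T) d / 2 * X.
  by rewrite sumr_const card_ord -[RHS]mulr_natr; ring.
apply: ler_sum => t _; rewrite -mulr_sumr ler_wpM2l//; first by lra.
apply: le_trans (sum_word_mean_sqr_onem_ge R K t d b q' a K2 d0 d2 b0 _ _).
- rewrite lerD2l lerN2 ler_wpM2l//; first exact: ltW.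
  by rewrite ler_wpM2l ?sqr_ge0// ler_nat ltnW.
- by move=> s i; exact: mixture_ge0.
- by move=> s; exact: mixture_sum1.
Qed.

End FixedRandomness.

(** * Measurability and integrability of the regret *)

(** A strategy is measurable at each history, whereas the history it reaches
    is itself random; with finitely many histories, the two combine. *)
Lemma measurable_finite_select (d : measure_display) (Om : measurableType d)
    (I : Type) (H : Om -> I) (Q : I -> set Om) :
  finite_set (range H) -> (forall i, measurable [set w | H w = i]) ->
  (forall i, measurable (Q i)) -> measurable [set w | Q (H w) w].
Proof.
move=> finH mH mQ.
have -> : [set w | Q (H w) w] =
    \bigcup_(i in range H) ([set w | H w = i] `&` Q i).
  apply/seteqP; split=> [w Qw|w [i _ [<-]]//].
  by exists (H w); [exists w|].
by apply: fin_bigcup_measurable => // i _; exact: measurableI.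
Qed.

Lemma measurable_fun_finite_select (d : measure_display)
    (Om : measurableType d) (R : realType) (I : Type) (H : Om -> I)
    (X : I -> Om -> R) :
  finite_set (range H) -> (forall i, measurable [set w | H w = i]) ->
  (forall i, measurable_fun [set: Om] (X i)) ->
  measurable_fun [set: Om] (fun w => X (H w) w).
Proof.
move=> finH mH mX _ Y mY; rewrite setTI.
apply: (measurable_finite_select _ _ _ H (fun i => X i @^-1` Y)) => // i.
by rewrite -[_ @^-1` _]setTI; exact: mX.
Qed.

Lemma measurable_cst_prop (d : measure_display) (Om : measurableType d)
    (Q : Prop) : measurable [set _ : Om | Q].
Proof.
have [q|nq] := pselect Q.
  by rewrite (_ : [set _ | _] = setT)//; apply/seteqP; split.
by rewrite (_ : [set _ | _] = set0)//; apply/seteqP; split.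
Qed.

Section RegretMeasurable.
Context {R : realType} {K p m : nat} {IC : bool} {dOm : measure_display}
  {Om : measurableType dOm}.
Variables (loss : R -> R -> R) (A : strategy R K p m IC Om).
Variables (F : 'I_K -> nat -> R) (y : nat -> R).

(** Along a fixed sequence, the next observation depends only on the past and
    on the queried set, and there are finitely many sets to query. *)
Lemma past_finite_measurable t :
  finite_set (range (past loss A F y t)) /\
  (forall h, measurable [set w | past loss A F y t w = h]).
Proof.
elim: t => [|t [finP mP]].
  split=> [|h].
    by apply: (@sub_finite_set _ _ [set [::]]) => // _ [w _ <-].
  exact: (measurable_cst_prop _ _ ([::] = h)).
pose next h (C : {set 'I_K}) : history R K :=
  rcons h [ffun i => if i \in C then Some (loss (F i t) (y t)) else None].
split=> [|h].
  apply: sub_finite_set (finite_image2 next finP (@finite_finset _ setT)).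
  move=> _ [w _ <-]; exists (past loss A F y t w); first by exists w.
  by exists (queried A (past loss A F y t w) w).
apply: (measurable_finite_select _ _ _ (past loss A F y t)
  (fun h' => [set w | next h' (queried A h' w) = h])) => // h'.
apply: (measurable_finite_select _ _ _ (queried A h')
  (fun C => [set w | next h' C = h])) => [|C|C].
- exact: finite_finset.
- exact: measurable_queried.
- exact: measurable_cst_prop.
Qed.

Lemma measurable_prediction t :
  measurable_fun [set: Om] (prediction loss A F y t).
Proof.
have [finP mP] := past_finite_measurable t.
apply: (measurable_fun_finite_select _ _ _ _ (past loss A F y t)
  (fun h w => \sum_(i in played A h w) weight A h i w * F i t)) => // h.
apply: (measurable_fun_finite_select _ _ _ _ (played A h)
  (fun S w => \sum_(i in S) weight A h i w * F i t)) => [|S|S].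
- exact: finite_finset.
- exact: measurable_played.
- have -> : (fun w => \sum_(i in S) weight A h i w * F i t) =
      (fun w => \sum_i if i \in S then weight A h i w * F i t else 0).
    by apply/funext => w; rewrite big_mkcond.
  apply: measurable_sum => i; case: (i \in S); last exact: measurable_cst.
  by apply: measurable_funM; [exact: measurable_weight|exact: measurable_cst].
Qed.

End RegretMeasurable.

Lemma measurable_regret (R : realType) (K T p m : nat) (IC : bool)
    (dOm : measure_display) (Om : measurableType dOm)
    (A : strategy R K p m IC Om) F y :
  measurable_fun [set: Om] (regret (@sqloss R) T A F y).
Proof.
apply: measurable_funB; last exact: measurable_cst.
apply: measurable_sum => t; apply: measurable_funX.
by apply: measurable_funB; [exact: measurable_prediction|exact: measurable_cst].
Qed.

Lemma prediction01 (R : realType) (loss : R -> R -> R) (K p m : nat) (IC : bool)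
    (dOm : measure_display) (Om : measurableType dOm)
    (A : strategy R K p m IC Om) F y t w :
  (forall i, 0 <= F i t <= 1) -> 0 <= prediction loss A F y t w <= 1.
Proof.
move=> F01; apply/andP; split.
  apply: sumr_ge0 => i iS; rewrite mulr_ge0 ?weight_ge0//.
  by case/andP: (F01 i).
rewrite -(weight_sum1 A (past loss A F y t w) w); apply: ler_sum => i iS.
by rewrite ler_piMr ?weight_ge0//; case/andP: (F01 i).
Qed.

Lemma integrable_regret (R : realType) (K T p m : nat) (IC : bool)
    (dOm : measure_display) (Om : measurableType dOm) (P : probability Om R)
    (A : strategy R K p m IC Om) F y :
  (forall t i, 0 <= F i t <= 1) -> (forall t, 0 <= y t <= 1) ->
  P.-integrable [set: Om] (EFin \o regret (@sqloss R) T A F y).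
Proof.
move=> F01 y01; apply: measurable_bounded_integrable => //.
- by rewrite (le_lt_trans (probability_le1 P _)) ?ltry.
- exact: measurable_regret.
rewrite /regret; set c := inf _.
exists (T%:R + `|c|); split; first exact: num_real.
move=> M TM w _; apply: le_trans (ltW TM).
apply: le_trans (ler_normB _ _) _; rewrite lerD2r.
rewrite ger0_norm; last by apply: sumr_ge0 => t _; exact: sqr_ge0.
rewrite -[T in leRHS]card_ord -sumr_const; apply: ler_sum => t _.
have /andP[p0 p1] :=
  prediction01 R (@sqloss R) K p m IC dOm Om A F y t w (F01 t).
by have /andP[y0 y1] := y01 t; rewrite /sqloss; nra.
Qed.

(** * Averaging over the internal randomness *)

Section IntegralOfMean.
Context {R : realType} {d : measure_display} {Om : measurableType d}
  (P : probability Om R).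

Lemma Rintegral_weighted_sum (I : Type) (r : seq I) (c : I -> R)
    (X : I -> Om -> R) :
  (forall i, P.-integrable [set: Om] (EFin \o X i)) ->
  P.-integrable [set: Om] (EFin \o (fun w => \sum_(i <- r) c i * X i w)) /\
  \int[P]_w (\sum_(i <- r) c i * X i w) = \sum_(i <- r) c i * \int[P]_w X i w.
Proof.
move=> iX; elim: r => [|i r [IHi IHr]].
  split.
    under eq_fun do rewrite big_nil.
    exact: finite_measure_integrable_cst.
  rewrite big_nil -[RHS](mul0r (fine (P setT))) -Rintegral_cst//.
  by apply: eq_Rintegral => w _; rewrite big_nil.
have iZ : P.-integrable [set: Om] (EFin \o (fun w => c i * X i w)).
  exact: (integrableZl _ (c i) (iX i)).
split.
  under eq_fun do rewrite big_cons.
  exact: (integrableD _ iZ IHi).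
rewrite big_cons -IHr -RintegralZl// -RintegralD//.
by apply: eq_Rintegral => w _; rewrite big_cons.
Qed.

Lemma Rintegral_word_mean (X : finType) (w : X -> R) n (g : seq X -> Om -> R) :
  (forall s, P.-integrable [set: Om] (EFin \o g s)) ->
  P.-integrable [set: Om] (EFin \o (fun o => word_mean w n (g ^~ o))) /\
  \int[P]_o word_mean w n (g ^~ o) = word_mean w n (fun s => \int[P]_o g s o).
Proof.
elim: n g => [|n IHn] g ig; first by split=> //=; exact: ig.
have S s := Rintegral_weighted_sum _ (index_enum X) w (fun x => g (rcons s x))
  (fun x => ig (rcons s x)).
have [i1 i2] := IHn (fun s o => \sum_x w x * g (rcons s x) o)
  (fun s => (S s).1).
split=> //=; rewrite i2; apply: eq_word_mean => s _; exact: (S s).2.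
Qed.

End IntegralOfMean.

Lemma exists_bad_forecast (R : realType) (K T p : nat) (IC : bool)
    (dOm : measure_display) (Om : measurableType dOm) (P : probability Om R)
    (A : strategy R K p 1 IC Om) (d b : R) : (2 <= K)%N ->
  0 <= d -> d ^+ 2 <= 2^-1 -> 0 < b ->
  exists (i : 'I_K) (s : seq (bool * bool)),
  d / 2 * T%:R * (4^-1 - (b + 1)^-1 - b * (d ^+ 2 * T%:R) / K%:R) <=
  \int[P]_w regret (@sqloss R) T A (forecast R K i s) (fun=> 0) w.
Proof.
move=> K2 d0 d2 b0; have d1 : d <= 1 by rewrite expr2 in d2; nra.
have d01 : 0 <= d <= 1 by rewrite d0.
have K0 : K%:R != 0 :> R by rewrite pnatr_eq0 -lt0n ltnW.
pose X i s := regret (@sqloss R) T A (forecast R K i s) (fun=> 0).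
have iX i s : P.-integrable [set: Om] (EFin \o X i s).
  apply: integrable_regret => [t j|t]; first exact: forecast01.
  by rewrite lexx ler01.
have IW i := Rintegral_word_mean P _ (coins d) T (X i) (iX i).
have [ia ie] := Rintegral_weighted_sum P _ (index_enum 'I_K) (fun=> K%:R^-1)
  _ (fun i => (IW i).1).
have iK0 (j : 'I_K) : 0 <= K%:R^-1 :> R by rewrite invr_ge0.
have iK1 : \sum_(j < K) K%:R^-1 = 1 :> R.
  by rewrite sumr_const card_ord -[LHS]mulr_natl divff.
have [i hi] := weighted_mean_attained _ iK0 iK1
  (fun i => \int[P]_o word_mean (coins d) T (X i ^~ o)).
have [s _ hs] := word_mean_attained _ (fun u => coins_ge0 d u d01)
  (coins_sum1 d) T (fun s => \int[P]_o X i s o).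
exists i, s; apply: le_trans hs; rewrite -(IW i).2; apply: le_trans hi.
rewrite -ie; set c := leLHS.
have -> : c = \int[P]_w c.
  by rewrite Rintegral_cst//= probability_setT mulr1.
apply: le_Rintegral => //; first exact: finite_measure_integrable_cst.
move=> w _; rewrite -mulr_sumr ler_pdivlMl ?ltr0n 1?ltnW//.
have -> : K%:R * c =
    d / 2 * T%:R * (K%:R * (4^-1 - (b + 1)^-1) - b * (d ^+ 2 * T%:R)).
  by rewrite /c; field; rewrite K0 gt_eqF// addr_gt0.
exact: sum_word_mean_regret_ge.
Qed.

Theorem theorem5p2 (R : realType) :
  exists c : R, 0 < c /\
    forall (K T p : nat) (IC : bool),
      (2 <= K)%N -> (K <= T)%N ->
      (1 <= p <= K)%N -> (IC -> (p <= 1)%N) ->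
      ((c * Num.sqrt ((K * T)%N%:R))%:E
        <= minimax_regret (@sqloss R) K T `[0%R, 1%R] `[0%R, 1%R] p 1 IC)%E.
Proof.
(* With d = sqrt (K / T) / 16 and b = 7, the lower bound of
   exists_bad_forecast is d / 2 * T * (1 / 8 - 7 / 256), which is
   25 / 8192 * sqrt (K * T); this exceeds sqrt (K * T) / 512. *)
exists 512^-1; split; first by rewrite invr_gt0.
move=> K T p IC K2 KT _ _.
apply: le_ereal_inf_tmp => _ [dOm [Om [P [A ->]]]].
have K0 : 0 < K%:R :> R by rewrite ltr0n ltnW.
have T0 : 0 < T%:R :> R by rewrite ltr0n (leq_trans _ KT)// ltnW.
have KT' : K%:R <= T%:R :> R by rewrite ler_nat.
pose r : R := Num.sqrt (K%:R / T%:R).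
have r2 : r ^+ 2 = K%:R / T%:R by rewrite sqr_sqrtr// divr_ge0// ltW.
have r0 : 0 <= r by exact: sqrtr_ge0.
have r1 : r ^+ 2 <= 1 by rewrite r2 ler_pdivrMr// mul1r.
have d2 : (r / 16) ^+ 2 <= 2^-1 by rewrite expr_div_n; lra.
have d0 : 0 <= r / 16 by rewrite divr_ge0.
have [i [s le_s]] := exists_bad_forecast R K T p IC dOm Om P A _ 7 K2 d0 d2
  (ltr0Sn _ _).
have bound : 512^-1 * Num.sqrt (K * T)%N%:R <= r / 16 / 2 * T%:R *
    (4^-1 - (7 + 1)^-1 - 7 * ((r / 16) ^+ 2 * T%:R) / K%:R).
  have -> : Num.sqrt (K * T)%N%:R = r * T%:R :> R.
    rewrite -[T%:R in RHS]ger0_norm ?ltW// -sqrtr_sqr -sqrtrM ?divr_ge0 ?ltW//.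
    by congr Num.sqrt; rewrite natrM; field; rewrite gt_eqF.
  rewrite expr_div_n r2.
  have -> : 7 * (K%:R / T%:R / 16 ^+ 2 * T%:R) / K%:R = 7 / 256 :> R.
    by field; rewrite !gt_eqF.
  have -> : r / 16 / 2 * T%:R * (4^-1 - (7 + 1)^-1 - 7 / 256) =
      25 / 8192 * (r * T%:R) by field.
  by rewrite ler_wpM2r ?mulr_ge0 ?(ltW T0)//; lra.
apply: (@le_trans _ _
  ('E_P[regret (@sqloss R) T A (forecast R K i s) (fun=> 0%R)])%E); last first.
  apply: ereal_sup_ubound; exists (forecast R K i s), (fun=> 0); split=> // t _.
  split=> [|j] /=; rewrite in_itv/= ?lexx ?ler01//; exact: forecast01.
rewrite unlock -[leRHS]fineK; first by rewrite lee_fin (le_trans bound).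
apply: integrable_fin_num => //; apply: integrable_regret => [t j|t].
  exact: forecast01.
by rewrite lexx ler01.
Qed.
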